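(* Let $M \models \mathbf{PA}^-$ and $n \geq 0$. The following are equivalent: 1. For every $N \models \mathbf{PA}^-$, if $M \prec N$, then $\sup_N(M) \prec_{\Sigma_{n+1}} N$. 2. $M \models \mathbf{Coll}_{\mathrm{s}}(\Sigma_{n+1})$. 3. (Case $n \geq 1$) $M \models \mathbf{Coll}(\Sigma_n)$ and for every $N \models \mathbf{PA}^- + \mathbf{Coll}(\Sigma_n)$, if $M \prec_{\Sigma_{n+1}} N$, then $\sup_N(M) \prec_{\Sigma_{n+1}} N$. (Case $n = 0$) For every $N \models \mathbf{PA}^-$, if $M \prec_{\Sigma_1} N$, then $\sup_N(M) \prec_{\Sigma_1} N$. 4. For every $N \models \mathbf{PA}^-$, if $M \prec_{\Sigma_{n+2}} N$, then $\sup_N(M) \prec_{\Sigma_{n+1}} N$.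
   Context: $\mathcal{L}_A=\{0,1,+,\times,<\}$ is the language of first-order arithmetic, and $\mathbf{PA}^-$ is the $\mathcal{L}_A$-theory of the non-negative parts of commutative discretely ordered rings. $\Delta_0=\Sigma_0=\Pi_0$ is the class of $\mathcal{L}_A$-formulas all of whose quantifiers are bounded; $\Sigma_{n+1}$ (resp. $\Pi_{n+1}$) formulas are those of the form $\exists \vec{y}\,\varphi$ with $\varphi\in\Pi_n$ (resp. $\forall \vec{y}\,\varphi$ with $\varphi\in\Sigma_n$), where $\vec{y}$ is a finite, possibly empty, tuple. Vector notation denotes finite (possibly empty) tuples of variables or elements; for tuples of the same length, $\vec{x}<\vec{u}$ means $x_i<u_i$ for every $i$. $M\subseteq N$ means $M$ is a substructure of $N$; $M\prec N$ means $N$ is an elementary extension of $M$; $M\prec_\Gamma N$ means $M\subseteq N$ and for every $\vec{a}\in M$ and every $\varphi(\vec{x})\in\Gamma$, $M\models\varphi(\vec{a})$ iff $N\models\varphi(\vec{a})$. For $M,N\models\mathbf{PA}^-$ with $M\subseteq N$, $\sup_N(M):=\{a\in N\mid \exists b\in M\ (N\models a\leq b)\}$, regarded as a substructure of $N$ (it is again a model of $\mathbf{PA}^-$). $\mathbf{Coll}(\Gamma)$ is the scheme $\forall \vec{z}\,\forall \vec{u}\,(\forall \vec{x}<\vec{u}\,\exists \vec{y}\,\varphi(\vec{x},\vec{y},\vec{z})\to\exists \vec{v}\,\forall \vec{x}<\vec{u}\,\exists \vec{y}<\vec{v}\,\varphi(\vec{x},\vec{y},\vec{z}))$ for $\varphi\in\Gamma$.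 $\mathbf{Coll}_{\mathrm{s}}(\Gamma)$ is the scheme $\forall \vec{z}\,\forall \vec{u}\,\exists \vec{v}\,\forall \vec{x}<\vec{u}\,(\exists \vec{y}\,\varphi(\vec{x},\vec{y},\vec{z})\to\exists \vec{y}<\vec{v}\,\varphi(\vec{x},\vec{y},\vec{z}))$ for $\varphi\in\Gamma$. *)

(* Defs.v *)
From mathcomp Require Import all_boot.
From mathcomp Require Import boolp.

Set Implicit Arguments.
Unset Strict Implicit.
Unset Printing Implicit Defensive.

Inductive term : Type :=
| Var of nat
| Zero
| One
| Add of term & term
| Mul of term & term.

(* De Bruijn indices: [All] and [Ex] bind variable 0 of their body. *)
Inductive formula : Type :=
| Eq of term & term
| Lt of term & term
| Not of formula
| And of formula & formula
| Or of formula & formula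
| Imp of formula & formula
| All of formula
| Ex of formula.

Fixpoint lift (t : term) : term :=
  match t with
  | Var i => Var i.+1
  | Zero => Zero
  | One => One
  | Add t1 t2 => Add (lift t1) (lift t2)
  | Mul t1 t2 => Mul (lift t1) (lift t2)
  end.

(* The bound of a bounded quantifier is a lifted term: it cannot mention the
   quantified variable. *)
Inductive Delta0 : formula -> Prop :=
| Delta0_Eq t1 t2 : Delta0 (Eq t1 t2)
| Delta0_Lt t1 t2 : Delta0 (Lt t1 t2)
| Delta0_Not p : Delta0 p -> Delta0 (Not p)
| Delta0_And p q : Delta0 p -> Delta0 q -> Delta0 (And p q)
| Delta0_Or p q : Delta0 p -> Delta0 q -> Delta0 (Or p q)
| Delta0_Imp p q : Delta0 p -> Delta0 q -> Delta0 (Imp p q)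
| Delta0_All t p :
    Delta0 p -> Delta0 (All (Imp (Lt (Var 0) (lift t)) p))
| Delta0_Ex t p :
    Delta0 p -> Delta0 (Ex (And (Lt (Var 0) (lift t)) p)).

Fixpoint Sigma (n : nat) (p : formula) : Prop :=
  if n is m.+1 then exists k q, Pi m q /\ p = iter k Ex q else Delta0 p
with Pi (n : nat) (p : formula) : Prop :=
  if n is m.+1 then exists k q, Sigma m q /\ p = iter k All q else Delta0 p.

Record structure : Type := Structure {
  carrier :> Type;
  szero : carrier;
  sone : carrier;
  sadd : carrier -> carrier -> carrier;
  smul : carrier -> carrier -> carrier;
  slt : carrier -> carrier -> Prop }.

Arguments szero {s}.
Arguments sone {s}.

Definition sle (M : structure) (a b : M) : Prop := slt a b \/ a = b.

Definition scons (T : Type) (a : T) (e : nat -> T) : nat -> T :=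
  fun i => if i is j.+1 then e j else a.

(* The entries of [s] become the values of the variables 0, 1, ... and the
   values given by [e] are moved after them. *)
Definition sapp (T : Type) (s : seq T) (e : nat -> T) : nat -> T :=
  foldr (@scons T) e s.

Fixpoint eval (M : structure) (e : nat -> M) (t : term) : M :=
  match t with
  | Var i => e i
  | Zero => szero
  | One => sone
  | Add t1 t2 => sadd (eval e t1) (eval e t2)
  | Mul t1 t2 => smul (eval e t1) (eval e t2)
  end.

Fixpoint sat (M : structure) (e : nat -> M) (p : formula) : Prop :=
  match p with
  | Eq t1 t2 => eval e t1 = eval e t2
  | Lt t1 t2 => slt (eval e t1) (eval e t2)
  | Not q => ~ sat e q
  | And q r => sat e q /\ sat e r
  | Or q r => sat e q \/ sat e r
  | Imp q r => sat e q -> sat e r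
  | All q => forall a : M, sat (scons a e) q
  | Ex q => exists a : M, sat (scons a e) q
  end.

(* Kaye's axiomatization of the theory of the non-negative parts of
   commutative discretely ordered rings. *)
Record PAminus (M : structure) : Prop := MkPAminus {
  PA_addA : forall a b c : M, sadd (sadd a b) c = sadd a (sadd b c);
  PA_addC : forall a b : M, sadd a b = sadd b a;
  PA_mulA : forall a b c : M, smul (smul a b) c = smul a (smul b c);
  PA_mulC : forall a b : M, smul a b = smul b a;
  PA_mulDr : forall a b c : M,
    smul a (sadd b c) = sadd (smul a b) (smul a c);
  PA_add0 : forall a : M, sadd a szero = a;
  PA_mul0 : forall a : M, smul a szero = szero;
  PA_mul1 : forall a : M, smul a sone = a;
  PA_lt_trans : forall a b c : M, slt a b -> slt b c -> slt a c;
  PA_lt_irr : forall a : M, ~ slt a a;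
  PA_lt_total : forall a b : M, slt a b \/ a = b \/ slt b a;
  PA_lt_add : forall a b c : M, slt a b -> slt (sadd a c) (sadd b c);
  PA_lt_mul : forall a b c : M,
    slt szero c -> slt a b -> slt (smul a c) (smul b c);
  PA_sub : forall a b : M, slt a b -> exists c : M, sadd a c = b;
  PA_lt01 : slt (szero : M) sone;
  PA_discrete : forall a : M, slt szero a -> sle sone a;
  PA_ge0 : forall a : M, sle szero a }.

Record embedding (M N : structure) : Type := Embedding {
  emb :> M -> N;
  emb_inj : injective emb;
  emb_zero : emb szero = szero;
  emb_one : emb sone = sone;
  emb_add : forall a b : M, emb (sadd a b) = sadd (emb a) (emb b);
  emb_mul : forall a b : M, emb (smul a b) = smul (emb a) (emb b);
  emb_lt : forall a b : M, slt (emb a) (emb b) <-> slt a b }.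

Definition elementary_for (G : formula -> Prop) (M N : structure)
    (f : embedding M N) : Prop :=
  forall p : formula, G p ->
  forall e : nat -> M, sat e p <-> sat (fun i => f (e i)) p.

Definition elementary (M N : structure) (f : embedding M N) : Prop :=
  elementary_for (fun _ => True) f.

Section Sup.

Variables (M N : structure) (hN : PAminus N) (f : embedding M N).

Definition in_sup (a : N) : Prop := exists b : M, sle a (f b).

Lemma sle_trans (a b c : N) : sle a b -> sle b c -> sle a c.
Proof.
move=> [ab|->] // [bc|<-]; last by left.
by left; exact: (PA_lt_trans hN ab bc).
Qed.

Lemma sle_add (a b c d : N) : sle a b -> sle c d -> sle (sadd a c) (sadd b d).
Proof.
have mono (x y z : N) : sle x y -> sle (sadd x z) (sadd y z).
  by move=> [xy|->]; [left; exact: (PA_lt_add hN) | right].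
move=> ab cd; apply: sle_trans (mono _ _ c ab) _.
by rewrite ![sadd b _](PA_addC hN); exact: mono.
Qed.

Lemma sle_mul (a b c d : N) : sle a b -> sle c d -> sle (smul a c) (smul b d).
Proof.
have mono (x y z : N) : sle x y -> sle (smul x z) (smul y z).
  case: (PA_ge0 hN z) => [z0|<-]; last by rewrite !(PA_mul0 hN); right.
  by move=> [xy|->]; [left; exact: (PA_lt_mul hN) | right].
move=> ab cd; apply: sle_trans (mono _ _ c ab) _.
by rewrite ![smul b _](PA_mulC hN); exact: mono.
Qed.

Lemma in_sup_zero : in_sup szero.
Proof. by exists szero; rewrite emb_zero; right. Qed.

Lemma in_sup_one : in_sup sone.
Proof. by exists sone; rewrite emb_one; right. Qed.

Lemma in_sup_add (a b : N) : in_sup a -> in_sup b -> in_sup (sadd a b).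
Proof.
by move=> [c ac] [d bd]; exists (sadd c d); rewrite emb_add; exact: sle_add.
Qed.

Lemma in_sup_mul (a b : N) : in_sup a -> in_sup b -> in_sup (smul a b).
Proof.
by move=> [c ac] [d bd]; exists (smul c d); rewrite emb_mul; exact: sle_mul.
Qed.

Definition sup : structure := {|
  carrier := {a : N | in_sup a};
  szero := exist _ szero in_sup_zero;
  sone := exist _ sone in_sup_one;
  sadd a b := exist _ (sadd (sval a) (sval b))
    (in_sup_add (svalP a) (svalP b));
  smul a b := exist _ (smul (sval a) (sval b))
    (in_sup_mul (svalP a) (svalP b));
  slt a b := slt (sval a) (sval b) |}.

Lemma sup_val_inj : injective (fun a : sup => sval a : N).
Proof.
move=> [a ha] [b hb] /= ab; case: b / ab hb => hb.
by congr exist; exact: Prop_irrelevance.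
Qed.

Definition sup_incl : embedding sup N :=
  @Embedding sup N (fun a => sval a) sup_val_inj erefl erefl
    (fun _ _ => erefl) (fun _ _ => erefl) (fun _ _ => iff_refl _).

End Sup.

Definition tuple_lt (M : structure) (k : nat) (x u : k.-tuple M) : Prop :=
  forall i : 'I_k, slt (tnth x i) (tnth u i).

(* In [p], the variables 0, ..., k - 1 are the x's, the next l ones are the
   y's and the remaining ones are the parameters z. *)
Definition Coll (G : formula -> Prop) (M : structure) : Prop :=
  forall p : formula, G p ->
  forall (k l : nat) (z : nat -> M) (u : k.-tuple M),
    (forall x : k.-tuple M, tuple_lt x u ->
       exists y : l.-tuple M, sat (sapp x (sapp y z)) p) ->
    exists v : l.-tuple M, forall x : k.-tuple M, tuple_lt x u ->
      exists y : l.-tuple M, tuple_lt y v /\ sat (sapp x (sapp y z)) p.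

Definition Coll_s (G : formula -> Prop) (M : structure) : Prop :=
  forall p : formula, G p ->
  forall (k l : nat) (z : nat -> M) (u : k.-tuple M),
    exists v : l.-tuple M, forall x : k.-tuple M, tuple_lt x u ->
      (exists y : l.-tuple M, sat (sapp x (sapp y z)) p) ->
      exists y : l.-tuple M, tuple_lt y v /\ sat (sapp x (sapp y z)) p.

(* Main.v *)
(* 1 -> 2: if Coll_s fails for a formula p and a bound u, every w in M has a
   tuple x_w < u with a witness for p but none below w. In an ultrapower of M
   over an ultrafilter on M containing all final segments, the class of
   w |-> x_w lies in the cofinal closure of M, so by 1 it has a witness there,
   hence one below some v in M; by Los this contradicts the choice of x_w for
   some w >= v.
   2 -> 3: for theta in Pi_m, m <= n, Coll_s gives v in M such that
   "for all x < u, if some y satisfies theta(x, y) then some y < v does". Given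
   Coll(Sigma_m), a bounded existential quantifier in front of a Pi_m formula can
   be absorbed, so this is Pi_{m+1} and passes from M to N. Hence witnesses in N for
   parameters in the cofinal closure can be found in the closure; conclude by
   induction on m.
   3 -> 4: for theta in Pi_m, an instance of collection for theta is Pi_{m+3}
   relative to Coll(Sigma_m), so Coll(Sigma_{m+1}) passes from M to N by induction
   on m < n. *)

Require Import Defs.
From mathcomp Require Import all_boot.
From mathcomp Require Import zify.
From mathcomp Require boolp filter.

Set Implicit Arguments.
Unset Strict Implicit.
Unset Printing Implicit Defensive.

Import boolp (funext, propext, contrapT, existsNP, pselect).

(** * Environments extended by finite blocks of values *)

Lemma sapp_nth (T : Type) (d : T) (s : seq T) (e : nat -> T) i :
  sapp s e i = if i < size s then nth d s i else e (i - size s).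
Proof. by elim: s i => [|a s IHs] [|i] //=; rewrite IHs. Qed.

Lemma sapp_cat (T : Type) (s t : seq T) (e : nat -> T) :
  sapp (s ++ t) e = sapp s (sapp t e).
Proof. exact: foldr_cat. Qed.

Lemma sapp_rcons (T : Type) (s : seq T) a (e : nat -> T) :
  sapp (rcons s a) e = sapp s (scons a e).
Proof. by rewrite -cats1 sapp_cat. Qed.

Lemma sapp_map (T U : Type) (f : T -> U) (s : seq T) (e : nat -> T) :
  (fun i => f (sapp s e i)) = sapp (map f s) (fun i => f (e i)).
Proof.
elim: s => [|a s IHs] //=; rewrite -IHs.
by apply: funext => -[|i].
Qed.

Lemma map_scons (T U : Type) (f : T -> U) a (e : nat -> T) :
  (fun i => f (scons a e i)) = scons (f a) (fun i => f (e i)).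
Proof. exact: (sapp_map f [:: a]). Qed.

Lemma ex_size0 (T : Type) (P : seq T -> Prop) :
  (exists y, size y = 0 /\ P y) <-> P [::].
Proof. by split=> [[y [/size0nil -> //]]|]; exists [::]. Qed.

(** Blocks are peeled from the right because in [iter k.+1 Ex q] the outermost quantifier binds the
    variable of highest index, the last entry of [y]. *)
Lemma ex_sizeS (T : Type) k (P : seq T -> Prop) :
  (exists y, size y = k.+1 /\ P y) <->
  exists a y, size y = k /\ P (rcons y a).
Proof.
split=> [[y []]|[a [y [sy Py]]]]; last first.
  by exists (rcons y a); rewrite size_rcons sy.
case/lastP: y => [|y a] //; rewrite size_rcons => -[sy] Py.
by exists a, y.
Qed.

(** * Renaming of variables and the arithmetical hierarchy *)

Fixpoint tren (r : nat -> nat) (t : term) : term :=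
  match t with
  | Var i => Var (r i)
  | Zero => Zero
  | One => One
  | Add t1 t2 => Add (tren r t1) (tren r t2)
  | Mul t1 t2 => Mul (tren r t1) (tren r t2)
  end.

Definition up (r : nat -> nat) (i : nat) : nat :=
  if i is j.+1 then (r j).+1 else 0.

Fixpoint ren (r : nat -> nat) (p : formula) : formula :=
  match p with
  | Eq t1 t2 => Eq (tren r t1) (tren r t2)
  | Lt t1 t2 => Lt (tren r t1) (tren r t2)
  | Not q => Not (ren r q)
  | And q1 q2 => And (ren r q1) (ren r q2)
  | Or q1 q2 => Or (ren r q1) (ren r q2)
  | Imp q1 q2 => Imp (ren r q1) (ren r q2)
  | All q => All (ren (up r) q)
  | Ex q => Ex (ren (up r) q)
  end.

Lemma eval_tren (M : structure) (e : nat -> M) r t :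
  eval e (tren r t) = eval (fun i => e (r i)) t.
Proof. by elim: t => //= t1 -> t2 ->. Qed.

Lemma lift_tren t : Defs.lift t = tren succn t.
Proof. by elim: t => //= t1 -> t2 ->. Qed.

Lemma eval_lift (M : structure) (e : nat -> M) a t :
  eval (scons a e) (Defs.lift t) = eval e t.
Proof. by rewrite lift_tren eval_tren. Qed.

Lemma tren_lift r t : tren (up r) (Defs.lift t) = Defs.lift (tren r t).
Proof. by elim: t => //= t1 -> t2 ->. Qed.

Lemma scons_up (T : Type) (a : T) e r :
  (fun i => scons a e (up r i)) = scons a (fun i => e (r i)).
Proof. by apply: funext => -[|i]. Qed.

Lemma sat_ren (M : structure) (e : nat -> M) r p :
  sat e (ren r p) <-> sat (fun i => e (r i)) p.
Proof.
elim: p e r => /= [t1 t2|t1 t2|p IHp|p IHp q IHq|p IHp q IHq|p IHp q IHq|p IHp|p IHp] e r;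
  rewrite ?eval_tren ?IHp ?IHq //.
- by split=> H a; move: (H a); rewrite IHp scons_up.
- by split=> -[a Ha]; exists a; move: Ha; rewrite IHp scons_up.
Qed.

Lemma Delta0_ren r p : Delta0 p -> Delta0 (ren r p).
Proof.
move=> Dp; elim: Dp r => {p} /=; try by constructor.
(* By [tren_lift] the renamed bound is again a lifted term, so the quantifier stays bounded. *)
- by move=> t p _ IHp r; rewrite tren_lift; constructor.
- by move=> t p _ IHp r; rewrite tren_lift; constructor.
Qed.

Lemma ren_iter_Ex r k p : ren r (iter k Ex p) = iter k Ex (ren (iter k up r) p).
Proof. by elim: k r => //= k IHk r; rewrite IHk -iterSr. Qed.

Lemma ren_iter_All r k p :
  ren r (iter k All p) = iter k All (ren (iter k up r) p).
Proof. by elim: k r => //= k IHk r; rewrite IHk -iterSr. Qed.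

Lemma Sigma_Pi_ren n :
  (forall r p, Sigma n p -> Sigma n (ren r p)) /\
  (forall r p, Pi n p -> Pi n (ren r p)).
Proof.
elim: n => [|n [IHS IHP]]; first by split=> r p; exact: Delta0_ren.
split=> r p [k [q [Gq ->]]]; exists k.
- by exists (ren (iter k up r) q); rewrite ren_iter_Ex; split=> //; exact: IHP.
- by exists (ren (iter k up r) q); rewrite ren_iter_All; split=> //; exact: IHS.
Qed.

Lemma Sigma_ren n r p : Sigma n p -> Sigma n (ren r p).
Proof. exact: (Sigma_Pi_ren n).1. Qed.

Lemma Pi_ren n r p : Pi n p -> Pi n (ren r p).
Proof. exact: (Sigma_Pi_ren n).2. Qed.

Lemma Pi_SigmaS n p : Pi n p -> Sigma n.+1 p.
Proof. by move=> Pp; exists 0, p. Qed.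

Lemma Sigma_PiS n p : Sigma n p -> Pi n.+1 p.
Proof. by move=> Sp; exists 0, p. Qed.

(** Level 0 rises by an empty block of quantifiers; afterwards the block is kept and its matrix
    rises in the dual class, whence the joint induction. *)
Lemma Sigma_Pi_S n :
  (forall p, Sigma n p -> Sigma n.+1 p) /\ (forall p, Pi n p -> Pi n.+1 p).
Proof.
elim: n => [|n [IHS IHP]]; first by split=> p Dp; exists 0, p.
by split=> p [k [q [Gq ->]]]; exists k, q; split=> //; [exact: IHP|exact: IHS].
Qed.

Lemma Sigma_mono m n p : m <= n -> Sigma m p -> Sigma n p.
Proof.
move=> /subnK <- Gp; elim: (n - m) => // d IHd.
exact: (Sigma_Pi_S _).1.
Qed.

Lemma Delta0_Sigma n p : Delta0 p -> Sigma n p.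
Proof. by move=> Dp; apply: (@Sigma_mono 0). Qed.

Lemma sat_iter_Ex (M : structure) (e : nat -> M) k q :
  sat e (iter k Ex q) <-> exists y, size y = k /\ sat (sapp y e) q.
Proof.
elim: k e => [|k IHk] e /=; first by rewrite ex_size0.
rewrite ex_sizeS; split=> -[a].
- by rewrite IHk => -[y [sy Hy]]; exists a, y; rewrite sapp_rcons.
- by move=> [y [sy]]; rewrite sapp_rcons => Hy; exists a; rewrite IHk; exists y.
Qed.

Lemma sat_iter_All (M : structure) (e : nat -> M) k q :
  sat e (iter k All q) <-> forall y, size y = k -> sat (sapp y e) q.
Proof.
elim: k e => [|k IHk] e /=; first by split=> [H y /size0nil ->|H]; [|exact: (H [::])].
split=> [H y|H a].
- case/lastP: y => [|y a] //; rewrite size_rcons sapp_rcons => -[sy].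
  by move: (H a); rewrite IHk; exact.
- by rewrite IHk => y sy; rewrite -sapp_rcons; apply: H; rewrite size_rcons sy.
Qed.

(** * Free variables *)

Fixpoint tfree_bound (t : term) : nat :=
  match t with
  | Var i => i.+1
  | Zero | One => 0
  | Add t1 t2 | Mul t1 t2 => maxn (tfree_bound t1) (tfree_bound t2)
  end.

(** A strict upper bound for the free indices cuts an infinite environment down to a finite tuple,
    which can be bounded or quantified. *)
Fixpoint free_bound (p : formula) : nat :=
  match p with
  | Eq t1 t2 | Lt t1 t2 => maxn (tfree_bound t1) (tfree_bound t2)
  | Not q => free_bound q
  | And q1 q2 | Or q1 q2 | Imp q1 q2 => maxn (free_bound q1) (free_bound q2)
  | All q | Ex q => (free_bound q).-1
  end.

Lemma eval_agree (M : structure) (e e' : nat -> M) t :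
  (forall i, i < tfree_bound t -> e i = e' i) -> eval e t = eval e' t.
Proof.
elim: t => //= [i|t1 IH1 t2 IH2|t1 IH1 t2 IH2] H; first exact: H.
all: by rewrite IH1 ?IH2 // => i Hi; apply: H; lia.
Qed.

Lemma sat_agree (M : structure) (e e' : nat -> M) p :
  (forall i, i < free_bound p -> e i = e' i) -> sat e p <-> sat e' p.
Proof.
have sc (q : formula) (f f' : nat -> M) a :
    (forall i, i < (free_bound q).-1 -> f i = f' i) ->
    forall i, i < free_bound q -> scons a f i = scons a f' i.
  by move=> H [|i] //= Hi; apply: H; lia.
elim: p e e' => /= [t1 t2|t1 t2|p IHp|p IHp q IHq|p IHp q IHq|p IHp q IHq|p IHp|p IHp] e e' H.
1,2: by rewrite (@eval_agree _ e e' t1) ?(@eval_agree _ e e' t2) // => i Hi; apply: H; lia.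
- by rewrite (IHp _ _ H).
1,2,3: by rewrite (IHp e e') ?(IHq e e') // => i Hi; apply: H; lia.
- by split=> Hs a; move: (Hs a); rewrite (IHp _ _ (sc _ _ _ a H)).
- by split=> -[a Hs]; exists a; move: Hs; rewrite (IHp _ _ (sc _ _ _ a H)).
Qed.

(** * Definability over a class of structures *)

Definition assertion := forall M : structure, (nat -> M) -> Prop.

(** One formula [p] must serve all structures of [K] at once: this admits equivalences that rest on
    collection and still lets elementarity compare two members of [K]. *)
Definition definable (K : structure -> Prop) (G : formula -> Prop)
    (S : assertion) : Prop :=
  exists2 p, G p & forall M, K M -> forall e : nat -> M, sat e p <-> S M e.

Lemma definable_ext (K : structure -> Prop) G (S T : assertion) :
  (forall M : structure, K M -> forall e : nat -> M, S M e <-> T M e) ->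
  definable K G S -> definable K G T.
Proof.
move=> ST [p Gp HS]; exists p => // M KM e.
by rewrite -ST // HS.
Qed.

Lemma definable_sub K (G G' : formula -> Prop) S :
  (forall p, G p -> G' p) -> definable K G S -> definable K G' S.
Proof. by move=> GG' [p Gp HS]; exists p => //; exact: GG'. Qed.

Lemma definable_sat K (G : formula -> Prop) p : G p -> definable K G (fun _ e => sat e p).
Proof. by move=> Gp; exists p. Qed.

Lemma definable_Sigma_ren K n (S : assertion) r :
  definable K (Sigma n) S ->
  definable K (Sigma n) (fun _ e => S _ (fun i => e (r i))).
Proof.
move=> [p Gp HS]; exists (ren r p); first exact: Sigma_ren.
by move=> M KM e; rewrite sat_ren HS.
Qed.

Lemma definable_lt K i j : definable K Delta0 (fun M e => slt (e i) (e j)).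
Proof. by exists (Lt (Var i) (Var j)) => //; constructor. Qed.

Lemma definable_Ex K n S :
  definable K (Sigma n.+1) S ->
  definable K (Sigma n.+1) (fun M e => exists a, S M (scons a e)).
Proof.
move=> [p [k [q [Pq ->]]] HS]; exists (Ex (iter k Ex q)).
  by exists k.+1, q.
by move=> M KM e /=; split=> -[a Ha]; exists a; move: Ha; rewrite HS.
Qed.

Lemma definable_All K n S :
  definable K (Pi n.+1) S ->
  definable K (Pi n.+1) (fun M e => forall a, S M (scons a e)).
Proof.
move=> [p [k [q [Pq ->]]] HS]; exists (All (iter k All q)).
  by exists k.+1, q.
by move=> M KM e /=; split=> Ha a; move: (Ha a); rewrite HS.
Qed.

(** The negation moves inwards past one quantifier of the block at a time; it exchanges the classes,
    so both parts go through the induction together. *)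
Lemma definable_Sigma_Pi_not K n :
  (forall S, definable K (Sigma n) S ->
    definable K (Pi n) (fun _ e => ~ S _ e)) /\
  (forall S, definable K (Pi n) S ->
    definable K (Sigma n) (fun _ e => ~ S _ e)).
Proof.
elim: n => [|n [IHS IHP]].
  by split=> S [p Dp HS]; exists (Not p); [constructor| |constructor|] => //
    M KM e /=; rewrite HS.
split=> S [p [k [q [Gq ->]]] HS].
- apply: (@definable_ext _ _ (fun _ e => ~ sat e (iter k Ex q))) => [M KM e|].
    by rewrite HS.
  elim: k {S HS} => [|k IHk] /=.
    exact: definable_sub (@Sigma_PiS _) (IHP _ (definable_sat _ Gq)).
  apply: definable_ext (definable_All IHk) => M KM e.
  by split=> [H [a]|H a Ha]; [exact: H|apply: H; exists a].
- apply: (@definable_ext _ _ (fun _ e => ~ sat e (iter k All q))) => [M KM e|].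
    by rewrite HS.
  elim: k {S HS} => [|k IHk] /=.
    exact: definable_sub (@Pi_SigmaS _) (IHS _ (definable_sat _ Gq)).
  apply: definable_ext (definable_Ex IHk) => M KM e.
  by rewrite existsNP.
Qed.

Lemma definable_not_Sigma K n S :
  definable K (Sigma n) S -> definable K (Pi n) (fun _ e => ~ S _ e).
Proof. exact: (definable_Sigma_Pi_not K n).1. Qed.

Lemma definable_not_Pi K n S :
  definable K (Pi n) S -> definable K (Sigma n) (fun _ e => ~ S _ e).
Proof. exact: (definable_Sigma_Pi_not K n).2. Qed.

Lemma definable_Pi_ren K n (S : assertion) r :
  definable K (Pi n) S ->
  definable K (Pi n) (fun _ e => S _ (fun i => e (r i))).
Proof.
move=> [p Gp HS]; exists (ren r p); first exact: Pi_ren.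
by move=> M KM e; rewrite sat_ren HS.
Qed.


Section DefinableOp.

Variable op : Prop -> Prop -> Prop.
Hypothesis opC : forall A B, op A B <-> op B A.
Hypothesis op_ex : forall (T : Type) (t : T) (A : T -> Prop) (B : Prop),
  op (exists a, A a) B <-> exists a, op (A a) B.

Lemma op_iff A B C D : (A <-> B) -> (C <-> D) -> op A C <-> op B D.
Proof. by move=> /propext -> /propext ->. Qed.

(** [op] stands for conjunction or disjunction. The quantifiers of [S] are pulled out one by one,
    and each time [T] is shifted past the new variable; hence the closure of [C] under renaming. *)
Lemma definable_op_prenex K n (C : assertion -> Prop) :
  (forall T r, C T -> C (fun _ e => T _ (fun i => e (r i)))) ->
  (forall S T, definable K (Pi n) S -> C T ->
    definable K (Sigma n.+1) (fun _ e => op (S _ e) (T _ e))) ->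
  forall S T, definable K (Sigma n.+1) S -> C T ->
    definable K (Sigma n.+1) (fun _ e => op (S _ e) (T _ e)).
Proof.
move=> Cren base S T [p [k [q [Gq ->]]] HS] CT.
apply: (@definable_ext _ _ (fun _ e => op (sat e (iter k Ex q)) (T _ e))).
  by move=> M KM e; apply: op_iff => //; rewrite HS.
elim: k T CT {S HS} => [|k IHk] T CT /=.
  by apply: base => //; exact: definable_sat.
apply: definable_ext (definable_Ex (IHk _ (Cren T succn CT))) => M KM e.
(* [szero] shows that the domain is inhabited, without which an existential quantifier could not be
   drawn from one disjunct to the whole disjunction. *)
by rewrite (op_ex szero).
Qed.

(** Two passes: first the block of [S] moves out past the Sigma assertion [T], then the block of [T]
    moves out past the Pi matrix of [S]. *)
Lemma definable_op_Sigma K n S T :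
  (forall S T, definable K (Pi n) S -> definable K (Pi n) T ->
    definable K (Pi n) (fun _ e => op (S _ e) (T _ e))) ->
  definable K (Sigma n.+1) S -> definable K (Sigma n.+1) T ->
  definable K (Sigma n.+1) (fun _ e => op (S _ e) (T _ e)).
Proof.
move=> base.
apply: definable_op_prenex => [T' r|{}S {}T DS]; first exact: definable_Sigma_ren.
move=> DT; apply: (@definable_ext _ _ (fun _ e => op (T _ e) (S _ e))) => [M KM e|].
  exact: opC.
apply: (definable_op_prenex (C := definable K (Pi n))) DT DS => [T' r|S' T' DS' DT'].
  exact: definable_Pi_ren.
exact: definable_sub (@Pi_SigmaS _) (base _ _ DS' DT').
Qed.

End DefinableOp.

Lemma definable_and_or_Sigma_Pi K n :
  (forall S T, definable K (Sigma n) S -> definable K (Sigma n) T ->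
    definable K (Sigma n) (fun _ e => S _ e /\ T _ e) /\
    definable K (Sigma n) (fun _ e => S _ e \/ T _ e)) /\
  (forall S T, definable K (Pi n) S -> definable K (Pi n) T ->
    definable K (Pi n) (fun _ e => S _ e /\ T _ e) /\
    definable K (Pi n) (fun _ e => S _ e \/ T _ e)).
Proof.
elim: n => [|n [_ IHP]].
  by split=> S T [p Dp HS] [q Dq HT]; split;
    [exists (And p q)|exists (Or p q)|exists (And p q)|exists (Or p q)];
    try (by constructor); move=> M KM e /=; rewrite HS // HT.
have Sig S T : definable K (Sigma n.+1) S -> definable K (Sigma n.+1) T ->
    definable K (Sigma n.+1) (fun _ e => S _ e /\ T _ e) /\
    definable K (Sigma n.+1) (fun _ e => S _ e \/ T _ e).
  move=> DS DT; split; apply: definable_op_Sigma => //.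
  - by move=> A B; tauto.
  - by move=> U t A B; split=> [[[a Aa] HB]|[a [Aa HB]]]; [exists a|split=> //; exists a].
  - by move=> S' T' DS' DT'; case: (IHP _ _ DS' DT').
  - by move=> A B; tauto.
  - move=> U t A B; split=> [[[a Aa]|HB]|[a [Aa|HB]]]; last by right.
    + by exists a; left.
    + by exists t; right.
    + by left; exists a.
  - by move=> S' T' DS' DT'; case: (IHP _ _ DS' DT').
(* The Pi case follows from the Sigma case by De Morgan. *)
split=> // S T /definable_not_Pi DS /definable_not_Pi DT.
case: (Sig _ _ DS DT) => /definable_not_Sigma D1 /definable_not_Sigma D2.
split; [apply: definable_ext D2|apply: definable_ext D1] => M KM e;
  case: (pselect (S M e)); case: (pselect (T M e)); move=> ? ?; tauto.
Qed.

Lemma definable_imp_Sigma K n S T :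
  definable K (Pi n) S -> definable K (Sigma n) T ->
  definable K (Sigma n) (fun _ e => S _ e -> T _ e).
Proof.
move=> /definable_not_Pi DS DT.
case: ((definable_and_or_Sigma_Pi K n).1 _ _ DS DT) => _.
by apply: definable_ext => M KM e; case: (pselect (S M e)) => ?; tauto.
Qed.

Lemma definable_imp_Pi K n S T :
  definable K (Sigma n) S -> definable K (Pi n) T ->
  definable K (Pi n) (fun _ e => S _ e -> T _ e).
Proof.
move=> /definable_not_Sigma DS DT.
case: ((definable_and_or_Sigma_Pi K n).2 _ _ DS DT) => _.
by apply: definable_ext => M KM e; case: (pselect (S M e)) => ?; tauto.
Qed.

(** * Blocks of elements and the collection schemes *)

(** A single bound for all entries replaces the tuple of bounds in the schemes, so a bounded block
    needs just one variable for its bound. *)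
Fixpoint below (M : structure) (y : seq M) (v : M) : Prop :=
  if y is a :: y' then slt a v /\ below y' v else True.

Lemma below_rcons (M : structure) (y : seq M) a v :
  below (rcons y a) v <-> slt a v /\ below y v.
Proof. by elim: y => //= b y ->; tauto. Qed.

Lemma below_cat (M : structure) (y z : seq M) v :
  below (y ++ z) v <-> below y v /\ below z v.
Proof. by elim: y => [|b y /= ->] /=; tauto. Qed.

Lemma below_nth (M : structure) (d : M) y v :
  below y v <-> forall i, i < size y -> slt (nth d y i) v.
Proof.
elim: y => //= a y ->; split=> [[Ha Hy] [|i] //= Hi|H]; first exact: Hy.
by split=> [|i Hi]; [exact: (H 0)|exact: (H i.+1)].
Qed.

Lemma below_tuple_lt (M : structure) k (y v : k.-tuple M) b :
  (forall i, tnth v i = b) -> below y b <-> tuple_lt y v.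
Proof.
move=> vb; rewrite (below_nth szero) size_tuple.
split=> [H i|H i Hi]; first by rewrite vb (tnth_nth szero); exact: H.
by rewrite -(vb (Ordinal Hi)) -(tnth_nth _ _ (Ordinal Hi)); exact: H.
Qed.

Lemma ltS (M : structure) : PAminus M -> forall a : M, slt a (sadd a sone).
Proof.
move=> hM a; have := PA_lt_add hM a (PA_lt01 hM).
by rewrite ![sadd _ a](PA_addC hM) (PA_add0 hM).
Qed.

Lemma below_mono (M : structure) : PAminus M ->
  forall (y : seq M) v w, sle v w -> below y v -> below y w.
Proof.
move=> hM y v w [vw|-> //]; elim: y => //= a y IHy [av yv]; split; last exact: IHy.
exact: (PA_lt_trans hM av vw).
Qed.

Lemma below_bound (M : structure) : PAminus M ->
  forall y : seq M, exists v, below y v.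
Proof.
move=> hM; elim=> [|a y [v yv]]; first by exists szero.
case: (PA_lt_total hM a v) => [av|va]; first by exists v.
have Ha := ltS hM a; exists (sadd a sone); split=> //.
apply: (below_mono hM) yv; left; case: va => [<- //|va].
exact: (PA_lt_trans hM va Ha).
Qed.

Lemma below_tuple_bound (M : structure) : PAminus M ->
  forall k (u : k.-tuple M), exists U, forall x : k.-tuple M, tuple_lt x u -> below x U.
Proof.
move=> hM k u; have [U uU] := below_bound hM u; exists U => x xu.
rewrite (below_nth szero) => i; rewrite size_tuple => Hi.
apply: (PA_lt_trans hM (b := nth szero u i)).
  by have := xu (Ordinal Hi); rewrite !(tnth_nth szero).
by move: uU; rewrite (below_nth szero); apply; rewrite size_tuple.
Qed.

(* The tuples have a common bound, and the y's precede the x's as they do when the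
   innermost quantifiers bind the y's. *)
Definition Coll_block (G : formula -> Prop) (M : structure) : Prop :=
  forall q, G q -> forall (k l : nat) (e : nat -> M) (u : M),
  (forall x, size x = k -> below x u ->
     exists y, size y = l /\ sat (sapp y (sapp x e)) q) ->
  exists v, forall x, size x = k -> below x u ->
    exists y, size y = l /\ (below y v /\ sat (sapp y (sapp x e)) q).

Lemma tnth_nseq_tuple (T : Type) k (b : T) i : tnth (nseq_tuple k b) i = b.
Proof. by rewrite (tnth_nth b) nth_nseq ltn_ord. Qed.

(** The schemes list the x's before the y's, whereas quantifying out the y's needs them first. *)
Definition swap_blocks (k l i : nat) : nat :=
  if i < l then k + i else if i < k + l then i - l else i.

Lemma sapp_swap (T : Type) (d : T) (x y : seq T) e :
  (fun i => sapp x (sapp y e) (swap_blocks (size x) (size y) i)) =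
  sapp y (sapp x e).
Proof.
apply: funext => i; rewrite !(sapp_nth d) /swap_blocks.
case: (ltnP i (size y)) => iy; first by rewrite ltnNge leq_addr /= addKn iy.
case: (ltnP i (size x + size y)) => ixy; last first.
  by do 3 (case: ifP => ?; first by lia); congr e; lia.
by rewrite (_ : i - size y < size x) //; lia.
Qed.

Lemma sat_swap (M : structure) (x y : seq M) e q :
  sat (sapp x (sapp y e)) (ren (swap_blocks (size x) (size y)) q) <->
  sat (sapp y (sapp x e)) q.
Proof. by rewrite sat_ren sapp_swap //; exact: szero. Qed.

Lemma Coll_Coll_block (M : structure) n : PAminus M ->
  Coll (Sigma n.+1) M -> Coll_block (Pi n) M.
Proof.
move=> hM cM q Pq k l e u H.
have Sq : Sigma n.+1 (ren (swap_blocks k l) q).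
  by apply: Pi_SigmaS; exact: Pi_ren.
have sw (x : k.-tuple M) (y : l.-tuple M) :
    sat (sapp x (sapp y e)) (ren (swap_blocks k l) q) <-> sat (sapp y (sapp x e)) q.
  by have := sat_swap x y e q; rewrite !size_tuple.
have nb := below_tuple_lt _ (@tnth_nseq_tuple M _ _).
case: (cM _ Sq k l e (nseq_tuple k u)) => [x|v Hv].
  rewrite -nb => xu; have [y [sy Hy]] := H x (size_tuple x) xu.
  by have/eqP sy' := sy; exists (Tuple sy'); rewrite sw.
have [w vw] := below_tuple_bound hM v; exists w => x sx xu.
have/eqP sx' := sx; have := Hv (Tuple sx').
rewrite -nb => /(_ xu) [y [yv]]; rewrite sw => Hy.
by exists y; rewrite size_tuple; split=> //; split=> //; exact: vw.
Qed.

Lemma definable_guard K k a b :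
  definable K Delta0 (fun M e => forall i, i < k -> slt (e (a + i)) (e (b + i))).
Proof.
elim: k => [|k [p Dp IHp]]; first by exists (Eq Zero Zero); [exact: Delta0_Eq|].
exists (And p (Lt (Var (a + k)) (Var (b + k)))).
  by apply: Delta0_And => //; exact: Delta0_Lt.
move=> M KM e /=; rewrite IHp //; split=> [[H Hk] i|H].
  by rewrite ltnS leq_eqVlt => /predU1P[->//|]; exact: H.
by split=> [i ik|]; apply: H => //; exact: ltnW.
Qed.

(** Lets a matrix written for the blocks w, x, y be read in the environment w, y, x, u, where the
    bounds u have become parameters and w, y form one block of witnesses. *)
Definition insert_block (j k l i : nat) : nat :=
  if i < j then i else if i < j + k then i + l
  else if i < j + k + l then i - k else i + k.

Lemma sapp_insert (T : Type) (d : T) (w x y u : seq T) e :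
  size u = size x ->
  (fun i => sapp (w ++ y) (sapp x (sapp u e))
     (insert_block (size w) (size x) (size y) i)) =
  sapp w (sapp x (sapp y e)).
Proof.
move=> su; apply: funext => i; rewrite !sapp_cat !(sapp_nth d) /insert_block su.
case: (ltnP i (size w)) => [-> //|wi].
case: (ltnP i (size w + size x)) => wxi.
  by do ![case: ifP => ?]; try lia; congr nth; lia.
case: (ltnP i (size w + size x + size y)) => wxyi.
  by do ![case: ifP => ?]; try lia; congr nth; lia.
by do ![case: ifP => ?]; try lia; congr e; lia.
Qed.

(** The leading existential block w of the Sigma formula joins the y's as one block of witnesses.
    The entrywise bounds u are weakened to a common bound U, and a guard makes the matrix vacuously
    true for x below U but not below u. *)
Lemma Coll_block_Coll (M : structure) n : PAminus M ->
  Coll_block (Pi n) M -> Coll (Sigma n.+1) M.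
Proof.
move=> hM cM p [j [q [Pq ->]]] k l z u H.
have [q' Pq' Hq'] : definable xpredT (Pi n) (fun M e =>
    (forall i, i < k -> slt (e (j + l + i)) (e (j + l + k + i))) ->
    sat (fun i => e (insert_block j k l i)) q).
  apply: definable_imp_Pi.
    exact: definable_sub (@Delta0_Sigma n) (definable_guard _ _ _ _).
  exact: definable_Pi_ren (definable_sat _ Pq).
have guardE (y : seq M) (x : k.-tuple M) : size y = j + l ->
    (forall i, i < k -> slt (sapp y (sapp x (sapp u z)) (j + l + i))
                            (sapp y (sapp x (sapp u z)) (j + l + k + i))) <->
    tuple_lt x u.
  move=> sy; have nE i : i < k ->
      sapp y (sapp x (sapp u z)) (j + l + i) = nth szero x i /\
      sapp y (sapp x (sapp u z)) (j + l + k + i) = nth szero u i.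
    move=> ik; rewrite !(sapp_nth szero) !size_tuple sy.
    by split; do ![case: ifP => ?]; try lia; congr nth; lia.
  split=> [G i|xu i ik].
    by have [E1 E2] := nE _ (ltn_ord i); rewrite !(tnth_nth szero) -E1 -E2; exact: G.
  by have [-> ->] := nE _ ik; have := xu (Ordinal ik); rewrite !(tnth_nth szero).
have qE (w y : seq M) (x : k.-tuple M) : size w = j -> size y = l ->
    sat (fun i => sapp (w ++ y) (sapp x (sapp u z)) (insert_block j k l i)) q <->
    sat (sapp w (sapp x (sapp y z))) q.
  move=> sw sy; rewrite -(@sapp_insert _ szero w x y u z) ?size_tuple //.
  by rewrite sw sy.
have [U HU] := below_tuple_bound hM u.
case: (cM _ Pq' k (j + l) (sapp u z) U) => [x sx _|v Hv].
  have/eqP sx' := sx; pose t := Tuple sx'.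
  case: (pselect (tuple_lt t u)) => xu.
    have [y] := H t xu; rewrite sat_iter_Ex => -[w [sw Hw]].
    exists (w ++ y); rewrite size_cat size_tuple sw; split=> //.
    by rewrite Hq' // => _; apply/(qE _ _ t); rewrite ?size_tuple.
  (* Outside [u] the guard fails, so any block of the right length is a witness; zeros are taken. *)
  exists (nseq (j + l) szero); rewrite size_nseq; split=> //.
  by rewrite Hq' // => /(guardE _ t); rewrite size_nseq => /(_ erefl) /xu.
exists (nseq_tuple l v) => x xu.
have [y [sy [yv]]] := Hv x (size_tuple x) (HU _ xu).
rewrite Hq' // => /(_ ((guardE _ _ sy).2 xu)) Hy.
have sw : size (take j y) = j by rewrite size_takel // sy leq_addr.
have sd : size (drop j y) == l by rewrite size_drop sy addKn.
exists (Tuple sd); split.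
  rewrite -(below_tuple_lt _ (@tnth_nseq_tuple M _ v)) /=.
  by move: yv; rewrite -{1}(cat_take_drop j y) below_cat => -[].
rewrite sat_iter_Ex; exists (take j y); split=> //.
by rewrite -qE //= ?cat_take_drop //; exact/eqP.
Qed.

(** * Bounded quantifiers *)

(** Level 0 imposes no collection, which makes the case n = 0 uniform with the others. *)
Definition PAColl (n : nat) (M : structure) : Prop :=
  PAminus M /\ (0 < n -> Coll (Sigma n) M).

Lemma Coll_sub (G G' : formula -> Prop) M :
  (forall p, G p -> G' p) -> Coll G' M -> Coll G M.
Proof. by move=> GG' cM p /GG'; exact: cM. Qed.

Lemma PAColl_mono m n M : m <= n -> PAColl n M -> PAColl m M.
Proof.
move=> mn [hM cM]; split=> // m0; apply: Coll_sub (cM _); last exact: leq_trans mn.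
by move=> p; exact: Sigma_mono.
Qed.

Definition bounded_ex (i : nat) (S : assertion) : assertion :=
  fun M e => exists a, slt a (e i) /\ S M (scons a e).

Definition bounded_all (i : nat) (S : assertion) : assertion :=
  fun M e => forall a, slt a (e i) -> S M (scons a e).

Definition block_ex (k i : nat) (S : assertion) : assertion :=
  fun M e => exists y, size y = k /\ (below y (e i) /\ S M (sapp y e)).

Lemma definable_bounded_Delta0 K i S : definable K Delta0 S ->
  definable K Delta0 (bounded_ex i S) /\ definable K Delta0 (bounded_all i S).
Proof.
move=> [p Dp HS]; split.
- exists (Ex (And (Lt (Var 0) (Defs.lift (Var i))) p)); first by constructor.
  by move=> M KM e; split=> -[a [/= ai Ha]]; exists a; split; rewrite /= ?eval_lift //;
    apply/HS.
- exists (All (Imp (Lt (Var 0) (Defs.lift (Var i))) p)); first by constructor.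
  by move=> M KM e /=; split=> H a Ha; move: (H a Ha); rewrite HS.
Qed.

Lemma definable_bounded_all_Pi K n i S :
  definable K (Pi n) S -> definable K (Pi n) (bounded_all i S).
Proof.
case: n => [|n] DS; first exact: (definable_bounded_Delta0 i DS).2.
apply: (definable_All (S := fun M e => slt (e 0) (e i.+1) -> S M e)).
apply: definable_imp_Pi DS.
exact: definable_sub (@Delta0_Sigma n.+1) (definable_lt _ _ _).
Qed.

Lemma definable_block_ex K (G : formula -> Prop) k i S :
  (forall i S, definable K G S -> definable K G (bounded_ex i S)) ->
  definable K G S -> definable K G (block_ex k i S).
Proof.
move=> bex DS; elim: k i => [|k IHk] i.
  apply: definable_ext DS => M KM e; rewrite /block_ex.
  by rewrite (ex_size0 (fun y => below y (e i) /\ S M (sapp y e))) /=; tauto.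
apply: definable_ext (bex i _ (IHk i.+1)) => M KM e.
rewrite /block_ex (ex_sizeS k (fun y => below y (e i) /\ S M (sapp y e))).
split=> [[a [ai [y [sy [yi Hy]]]]]|[a [y [sy []]]]].
  by exists a, y; rewrite below_rcons sapp_rcons.
rewrite below_rcons sapp_rcons => -[ai yi] Hy.
by exists a; split=> //; exists y.
Qed.

Definition skip (j d i : nat) : nat := if i < j then i else i + d.

Lemma sapp_skip (T : Type) (d : T) (s t : seq T) e :
  (fun i => sapp s (sapp t e) (skip (size s) (size t) i)) = sapp s e.
Proof.
apply: funext => i; rewrite /skip !(sapp_nth d).
case: (ltnP i (size s)) => [-> //|si].
by do ![case: ifP => ?]; try lia; congr e; lia.
Qed.

Lemma sat_skip (M : structure) (s t : seq M) e q :
  sat (sapp s (sapp t e)) (ren (skip (size s) (size t)) q) <-> sat (sapp s e) q.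
Proof. by rewrite sat_ren sapp_skip //; exact: szero. Qed.

(** At level n.+1 the dual is shown: for the Pi n matrix q of the negation, collection turns forall
    a < b, exists y, q into exists v, forall a < b, exists y < v, q. By induction the bounded
    existential block is absorbed in Pi n, so only the quantifier on v remains. *)
Lemma definable_bounded_ex_Pi K n i S :
  (forall M, K M -> PAColl n M) ->
  definable K (Pi n) S -> definable K (Pi n) (bounded_ex i S).
Proof.
elim: n i S => [|n IHn] i S HK DS; first exact: (definable_bounded_Delta0 i DS).1.
have {}IHn i' S' : definable K (Pi n) S' -> definable K (Pi n) (bounded_ex i' S').
  by apply: IHn => M /HK; exact: PAColl_mono.
have [p [k [q [Pq ->]]] HS] := definable_not_Pi DS.
suff /definable_not_Sigma : definable K (Sigma n.+1) (bounded_all i (fun _ e => ~ S _ e)).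
  apply: definable_ext => M KM e; split=> [/existsNP[a]|[a [ai Sa]] H].
    by move=> /boolp.not_implyP [ai /contrapT Sa]; exists a.
  exact: (H a ai).
(* The bound v sits between a and the parameters: it has index 1 once a is bound, the matrix skips
   it, and the old bound moves to [i.+1]. *)
pose body := block_ex k 1 (fun _ e => sat e (ren (skip k.+1 1) q)).
have Dbody : definable K (Pi n) (bounded_all i.+1 body).
  apply: definable_bounded_all_Pi; apply: definable_block_ex => //.
  by apply: definable_sat; exact: Pi_ren.
apply: definable_ext (definable_Ex (definable_sub (@Pi_SigmaS n) Dbody)) => M KM e.
have bodyE a v : body M (scons a (scons v e)) <->
    exists y, size y = k /\ (below y v /\ sat (sapp y (scons a e)) q).
  have skipE y : size y = k ->
      sat (sapp y (scons a (scons v e))) (ren (skip k.+1 1) q) <->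
      sat (sapp y (scons a e)) q.
    by move=> sy; have := sat_skip (rcons y a) [:: v] e q; rewrite size_rcons sy !sapp_rcons.
  by split=> -[y [sy [yv Hy]]]; exists y; move: Hy; rewrite skipE.
have ballE : (bounded_all i (fun M e => ~ S M e)) M e <->
    forall x, size x = 1 -> below x (e i) ->
      exists y, size y = k /\ sat (sapp y (sapp x e)) q.
  split=> [H [|a [|? ?]] //= _ [ai _]|H a ai].
    by have := H a ai; rewrite -HS // sat_iter_Ex.
  by rewrite -HS // sat_iter_Ex; exact: (H [:: a]).
rewrite ballE; have [hM /(_ isT) cM] := HK _ KM; split.
  move=> [v Hv] [|a [|? ?]] //= _ [ai _].
  by have [y [sy [yv Hy]]] := (bodyE a v).1 (Hv a ai); exists y.
move=> /(Coll_Coll_block hM cM Pq) [v Hv]; exists v => a ai.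
by rewrite bodyE; exact: (Hv [:: a]).
Qed.
Definition block_all (k i : nat) (S : assertion) : assertion :=
  fun M e => forall y, size y = k -> below y (e i) -> S M (sapp y e).

Lemma definable_block_all_Pi K n k i S :
  definable K (Pi n) S -> definable K (Pi n) (block_all k i S).
Proof.
move=> DS; elim: k i => [|k IHk] i.
  apply: definable_ext DS => M KM e.
  by split=> [H y /size0nil ->|H]; [|exact: (H [::])].
apply: definable_ext (definable_bounded_all_Pi i (IHk i.+1)) => M KM e.
split=> [H y|H a ai y sy yi].
  case/lastP: y => [|y a] //; rewrite size_rcons below_rcons sapp_rcons => -[sy] [ai yi].
  exact: H.
by rewrite -sapp_rcons; apply: H; rewrite ?size_rcons ?sy // below_rcons.
Qed.

Lemma definable_block_ex_Pi K n k i S :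
  (forall M, K M -> PAColl n M) ->
  definable K (Pi n) S -> definable K (Pi n) (block_ex k i S).
Proof.
by move=> HK; apply: definable_block_ex => i' S'; exact: definable_bounded_ex_Pi.
Qed.

(** * Elementarity and cofinal closures *)

Lemma elementary_for_definable K G M N (f : embedding M N) S :
  elementary_for G f -> definable K G S -> K M -> K N ->
  forall e : nat -> M, S M e <-> S N (fun i => f (e i)).
Proof. by move=> elf [p Gp HS] KM KN e; rewrite -!HS //; exact: elf. Qed.

Lemma elementary_for_sub (G G' : formula -> Prop) M N (f : embedding M N) :
  (forall p, G p -> G' p) -> elementary_for G' f -> elementary_for G f.
Proof. by move=> GG' elf p /GG'; exact: elf. Qed.

Lemma elementary_for_Pi n M N (f : embedding M N) :
  elementary_for (Sigma n) f -> elementary_for (Pi n) f.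
Proof.
move=> elf p Pp e.
have := elementary_for_definable elf
  (definable_not_Pi (definable_sat (fun _ => True) Pp)) I I e.
by case: (pselect (sat e p)); case: (pselect (sat (fun i => f (e i)) p)) => ? ?; tauto.
Qed.

Lemma sapp_mkseq (T : Type) (e : nat -> T) k : sapp (mkseq e k) (fun i => e (k + i)) = e.
Proof.
apply: funext => i; rewrite (sapp_nth (e 0)) size_mkseq.
by case: ltnP => ik; rewrite ?nth_mkseq ?subnKC.
Qed.

Lemma sat_tail (M : structure) (y x : seq M) e e' q :
  free_bound q <= size x ->
  sat (sapp y (sapp x e)) q <-> sat (sapp y (sapp x e')) q.
Proof.
move=> qx; apply: sat_agree => i iq; rewrite !(sapp_nth szero).
case: ifP => // iy; have -> // : i - size y < size x by lia.
Qed.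

(** Covers environments of N outside the image of M: the universal closure of a Pi n.+1 formula is
    again Pi n.+1 and has no free variables, so elementarity applies to it. *)
Lemma Pi_sentence_transfer K n M N (f : embedding M N) S :
  elementary_for (Sigma n.+1) f -> K M -> K N -> definable K (Pi n.+1) S ->
  (forall e : nat -> M, S M e) -> forall e : nat -> N, S N e.
Proof.
move=> elf KM KN [p Pp HS] SM e; rewrite -HS //.
pose k := free_bound p.
have Pk : Pi n.+1 (iter k All p).
  by case: Pp => j [q [Sq ->]]; exists (k + j), q; rewrite iterD.
have := (elementary_for_Pi elf Pk (fun _ => szero)).1.
rewrite !sat_iter_All => H.
rewrite -(sapp_mkseq e k) (sat_tail [::] _ (fun _ => f szero)) ?size_mkseq //.
apply: H; last by rewrite size_mkseq.
by move=> y _; rewrite HS.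
Qed.

Lemma eval_emb M N (f : embedding M N) e t :
  f (eval e t) = eval (fun i => f (e i)) t.
Proof.
elim: t => //= [||t1 <- t2 <-|t1 <- t2 <-].
- exact: emb_zero.
- exact: emb_one.
- exact: emb_add.
- exact: emb_mul.
Qed.

Section SupElementary.

Variables (M N : structure) (hM : PAminus M) (hN : PAminus N) (f : embedding M N).

Notation incl := (sup_incl hN f).

Lemma in_sup_lt (a b : N) : in_sup f b -> slt a b -> in_sup f a.
Proof.
by move=> [c bc] ab; exists c; apply: (sle_trans hN) bc; left.
Qed.

(** The closure is an initial segment of N closed under terms, so a bounded quantifier ranges over
    the same elements in both structures. *)
Lemma sup_Delta0 : elementary_for Delta0 incl.
Proof.
move=> p Dp; elim: Dp => {p}
  [t1 t2|t1 t2|p _ IHp|p q _ IHp _ IHq|p q _ IHp _ IHq|p q _ IHp _ IHq|t p _ IHp|t p _ IHp] e /=.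
- rewrite -!(eval_emb incl); split=> [-> //|]; exact: emb_inj.
- by rewrite -!(eval_emb incl).
- by rewrite IHp.
- by rewrite IHp IHq.
- by rewrite IHp IHq.
- by rewrite IHp IHq.
- split=> H a; rewrite ?eval_lift.
  + rewrite -(eval_emb incl) => at'; have sa := in_sup_lt (svalP (eval e t)) at'.
    have := H (exist _ a sa); rewrite eval_lift => /(_ at').
    by rewrite IHp map_scons.
  + have := H (sval a); rewrite eval_lift -(eval_emb incl) => Ha at'.
    by rewrite IHp map_scons; exact: Ha.
- split=> -[a]; rewrite eval_lift => -[at' Ha].
  + exists (sval a); rewrite eval_lift -(eval_emb incl); split=> //.
    by move: Ha; rewrite IHp map_scons.
  + move: at'; rewrite -(eval_emb incl) => at'.
    have sa := in_sup_lt (svalP (eval e t)) at'.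
    exists (exist _ a sa); rewrite eval_lift; split=> //.
    by rewrite IHp map_scons.
Qed.

Lemma in_sup_bound (y : seq (sup hN f)) : exists v : M, below (map (@sval _ _) y) (f v).
Proof.
elim: y => [|a y [v yv]] /=; first by exists szero.
have [b ab] := svalP a.
have [w /= [vw [bw _]]] := below_bound hM [:: v; b].
exists w; split.
  by case: ab => [ab|->]; [apply: (PA_lt_trans hN ab)|]; rewrite emb_lt.
by apply: (below_mono hN) yv; left; rewrite emb_lt.
Qed.

Lemma below_in_sup (y : seq N) v : below y (f v) ->
  exists y' : seq (sup hN f), y = map (@sval _ _) y'.
Proof.
elim: y => [|a y IHy] /=; first by exists [::].
move=> [av /IHy[y' ->]]; have sa : in_sup f a by exists v; left.
by exists (exist _ a sa :: y').
Qed.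

Lemma Coll_s_block (G : formula -> Prop) q k l (z : nat -> M) (u : M) :
  Coll_s G M -> G (ren (swap_blocks k l) q) ->
  exists v, forall x, size x = k -> below x u ->
    (exists y, size y = l /\ sat (sapp y (sapp x z)) q) ->
    exists y, size y = l /\ (below y v /\ sat (sapp y (sapp x z)) q).
Proof.
move=> cM Gq; have [v Hv] := cM _ Gq k l z (nseq_tuple k u).
have [w vw] := below_tuple_bound hM v; exists w => x sx xu [y [sy Hy]].
have/eqP sx' := sx; have/eqP sy' := sy.
have sw (t : l.-tuple M) : sat (sapp (Tuple sx') (sapp t z))
    (ren (swap_blocks k l) q) <-> sat (sapp t (sapp x z)) q.
  by have := sat_swap x t z q; rewrite size_tuple sx.
case: (Hv (Tuple sx')).
- by rewrite -(below_tuple_lt _ (@tnth_nseq_tuple M _ u)).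
- by exists (Tuple sy'); rewrite sw.
move=> t [tv]; rewrite sw => Ht; exists t; rewrite size_tuple; split=> //.
by split=> //; exact: vw.
Qed.

Lemma sup_elementary_Sigma n :
  Coll_s (Sigma n.+1) M -> PAColl n M -> PAColl n N ->
  elementary_for (Sigma n.+1) f ->
  forall m, m <= n.+1 -> elementary_for (Sigma m) incl.
Proof.
move=> csM cM cN elf; elim=> [_|m IHm mn]; first exact: sup_Delta0.
have {}IHm := elementary_for_Pi (IHm (ltnW mn)).
move=> p [l [q [Pq ->]]] e; rewrite !sat_iter_Ex; split=> -[y [sy Hy]].
  exists (map (@sval _ _) y); rewrite size_map; split=> //.
  by move: Hy; rewrite IHm // sapp_map.
(* [k] exceeds every free index of [q], so the witnesses and the first [k] parameters determine its
   truth; the tails used below are arbitrary. *)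
pose k := free_bound q.
have eE := sapp_mkseq (fun i => sval (e i)) k; set x := mkseq _ k in eE.
have sx : size x = k by rewrite size_mkseq.
have [u xu] : exists u, below x (f u).
  by have [u] := in_sup_bound (mkseq e k); rewrite -map_comp => xu; exists u; exact: xu.
have Sq : Sigma n.+1 (ren (swap_blocks k l) q).
  by apply: (@Sigma_mono m.+1) => //; apply: Pi_SigmaS; exact: Pi_ren.
have [v Hv] := Coll_s_block (fun _ => szero) u csM Sq.
(* Variable 0 carries the bound [u] of the x's and variable 1 the bound [v] of the witnesses; behind
   the [k] x's the latter has index [k.+1]. *)
pose e0 : nat -> M := scons u (scons v (fun _ => szero)).
pose A := block_all k 0 (fun M e => sat e (iter l Ex q) ->
  @block_ex l k.+1 (fun _ e => sat e q) M e).
have DA : definable (PAColl m) (Pi m.+1) A.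
  apply: definable_block_all_Pi; apply: definable_imp_Pi.
    by apply: definable_sat; exists l, q.
  apply: (@definable_sub _ (Pi m)); first exact: (Sigma_Pi_S m).2.
  by apply: definable_block_ex_Pi => //; exact: definable_sat.
have elm := elementary_for_Pi (elementary_for_sub (fun p => @Sigma_mono _ _ p mn) elf).
have := (elementary_for_definable elm DA (PAColl_mono (m := m) mn cM)
  (PAColl_mono (m := m) mn cN) e0).1.
have AM : A M e0.
  move=> x' sx' xu'; rewrite sat_iter_Ex => -[y' [sy' Hy']].
  case: (Hv x' sx' xu').
    by exists y'; split=> //; rewrite (sat_tail _ _ e0) // sx'.
  move=> y'' [sy'' [yv'' Hy'']]; exists y''; split=> //.
  rewrite (sapp_nth szero) sx' ltnNge leqnSn /= subSn // subnn; split=> //.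
  by rewrite (sat_tail _ _ (fun _ => szero)) // sx'.
(* [A] now holds in N, so the given witness may be replaced by one below [f v], which lies in the
   closure. *)
move=> /(_ AM x sx xu) [|y' [sy' [yv' Hy']]].
  rewrite sat_iter_Ex; exists y; split=> //.
  by rewrite (sat_tail _ _ (fun i => sval (e (k + i)))) ?sx // eE.
move: yv'; rewrite (sapp_nth (f szero)) sx ltnNge leqnSn /= subSn // subnn.
move=> /below_in_sup[y'' yE]; exists y''; rewrite -sy' yE size_map; split=> //.
rewrite IHm // sapp_map -yE /= -eE.
by rewrite (sat_tail _ _ (fun i => f (e0 i))) ?sx.
Qed.

End SupElementary.

(** * Transfer of collection to extensions *)

Lemma Coll_s_Coll (G : formula -> Prop) (M : structure) : Coll_s G M -> Coll G M.
Proof.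
move=> cM p Gp k l z u H; have [v Hv] := cM p Gp k l z u.
by exists v => x xu; apply: Hv => //; exact: H.
Qed.

Lemma Coll_transfer n (M N : structure) (f : embedding M N) : PAminus N -> PAColl n M ->
  elementary_for (Sigma n.+2) f -> PAColl n N.
Proof.
move=> hN cM elf; suff H m : m <= n -> PAColl m N by exact: H.
elim: m => [|m IHm] mn; first by split.
have {}IHm := IHm (ltnW mn); split=> // _.
apply: Coll_block_Coll => // q Pq k l e u.
(* [q1] makes room for the bound of the x's, [q2] also for the bound of the y's. *)
pose q1 := ren (skip (l + k) 1) q; pose q2 := ren (skip (l + k) 2) q.
have q1E (L : structure) (y x : seq L) a e' : size y = l -> size x = k ->
    sat (sapp y (sapp x (scons a e'))) q1 <-> sat (sapp y (sapp x e')) q.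
  by move=> sy sx; have := sat_skip (y ++ x) [:: a] e' q; rewrite size_cat sy sx !sapp_cat.
have q2E (L : structure) (y x : seq L) a b e' : size y = l -> size x = k ->
    sat (sapp y (sapp x (scons b (scons a e')))) q2 <-> sat (sapp y (sapp x e')) q.
  by move=> sy sx; have := sat_skip (y ++ x) [:: b; a] e' q; rewrite size_cat sy sx !sapp_cat.
pose H := block_all k 0 (fun _ e => sat e (iter l Ex q1)).
pose C := (fun M e => exists a : M,
  @block_all k 1 (block_ex l k (fun _ e => sat e q2)) M (scons a e)) : assertion.
have HE (L : structure) a (e' : nat -> L) : H L (scons a e') <->
    forall x, size x = k -> below x a ->
      exists y, size y = l /\ sat (sapp y (sapp x e')) q.
  by split=> HH x sx xa; move: (HH x sx xa); rewrite sat_iter_Ex => -[y [sy Hy]];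
    exists y; move: Hy; rewrite q1E.
have CE (L : structure) a (e' : nat -> L) : C L (scons a e') <->
    exists v, forall x, size x = k -> below x a ->
      exists y, size y = l /\ (below y v /\ sat (sapp y (sapp x e')) q).
  have kE (x : seq L) v : size x = k -> sapp x (scons v (scons a e')) k = v.
    by move=> sx; rewrite (sapp_nth szero) sx ltnn subnn.
  by split=> -[v HH]; exists v => x sx xa; move: (HH x sx xa) => -[y [sy [yv Hy]]];
    exists y; move: yv Hy; rewrite kE // q2E.
(* [H] is Pi m.+2 and [C] is Sigma m.+1, so the implication is Sigma m.+2 and hence Pi m.+3, within
   reach since m < n. *)
have DHC : definable (PAColl m) (Pi m.+3) (fun _ e => H _ e -> C _ e).
  apply: definable_sub (@Sigma_PiS m.+2) _; apply: definable_imp_Sigma.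
    apply: definable_block_all_Pi; apply: definable_sat; apply: Sigma_PiS.
    by exists l, q1; split=> //; exact: Pi_ren.
  apply: definable_sub (fun p => @Sigma_mono m.+1 m.+2 p (leqnSn _)) _.
  apply: definable_Ex; apply: definable_sub (@Pi_SigmaS m) _.
  apply: definable_block_all_Pi; apply: definable_block_ex_Pi => //.
  by apply: definable_sat; exact: Pi_ren.
have elm : elementary_for (Sigma m.+3) f.
  by apply: elementary_for_sub elf => p; apply: Sigma_mono.
have [hM cSM] := PAColl_mono mn cM.
(* The bound and the parameters come from N, so elementarity at points of M would not suffice; in M
   the implication is an instance of Coll(Sigma m.+1). *)
have := Pi_sentence_transfer elm (PAColl_mono (ltnW mn) cM) IHm DHC.
move=> HC; rewrite -HE -CE; apply: HC => e'.
rewrite -(sapp_mkseq e' 1) /= HE CE.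
exact: (Coll_Coll_block hM (cSM isT) Pq).
Qed.
(** * Ultrapowers *)

Section Ultrapower.

Variables (M : structure) (I : Type) (F : (I -> Prop) -> Prop).
Hypothesis FU : filter.UltraFilter F.

Let FF : filter.ProperFilter F := @filter.ultra_proper _ _ FU.

Lemma ultraS (P Q : I -> Prop) : (forall i, P i -> Q i) -> F P -> F Q.
Proof. exact: filter.filterS. Qed.

Lemma ultraT (P : I -> Prop) : (forall i, P i) -> F P.
Proof. by move=> HP; apply: (@ultraS (fun _ => True)) => //; exact: filter.filterT. Qed.

Lemma ultra_and (P Q : I -> Prop) : F (fun i => P i /\ Q i) <-> F P /\ F Q.
Proof.
split=> [H|[HP HQ]]; last exact: filter.filterI.
by split; apply: ultraS H => i [].
Qed.

Lemma ultra_ex (P : I -> Prop) : F P -> exists i, P i.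
Proof. exact: filter.filter_ex. Qed.

Lemma ultra_const (P : Prop) : F (fun _ => P) <-> P.
Proof. by split=> [/ultra_ex[]|HP] //; exact: ultraT. Qed.

Lemma ultra_not (P : I -> Prop) : F (fun i => ~ P i) <-> ~ F P.
Proof.
split=> [HN HP|HN].
  by have /ultra_ex[i []] := (ultra_and _ _).2 (conj HN HP).
by have [/HN|] := filter.in_ultra_setVsetC P FU.
Qed.

(** Points are classes of functions, not functions, because [Eq] is interpreted by equality in the
    carrier. *)
Definition uclass (g : I -> M) : (I -> M) -> Prop := fun h => F (fun i => g i = h i).

Definition upower_carrier := {c : (I -> M) -> Prop | exists g, c = uclass g}.

Definition ucls (g : I -> M) : upower_carrier :=
  exist _ (uclass g) (ex_intro _ g erefl).

Definition urep (c : upower_carrier) : I -> M := sval (boolp.cid (svalP c)).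

Lemma upower_carrier_eq (c d : upower_carrier) : sval c = sval d -> c = d.
Proof.
case: c d => [c hc] [d hd] /= cd; case: d / cd hd => hd.
by congr exist; exact: boolp.Prop_irrelevance.
Qed.

Lemma ucls_eq g h : ucls g = ucls h <-> F (fun i => g i = h i).
Proof.
split=> [[E]|H].
  have : uclass h h by exact: ultraT.
  by rewrite -E.
apply: upower_carrier_eq; apply: funext => k; apply: propext.
by split=> Hk; apply: ultraS ((ultra_and _ _).2 (conj H Hk)) => i [-> ].
Qed.

Lemma urepK c : ucls (urep c) = c.
Proof. by apply: upower_carrier_eq; rewrite /urep; case: boolp.cid => g /= <-. Qed.

Lemma urep_ucls g : F (fun i => urep (ucls g) i = g i).
Proof. by apply/ucls_eq; rewrite urepK. Qed.

Definition upower : structure := {|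
  carrier := upower_carrier;
  szero := ucls (fun _ => szero);
  sone := ucls (fun _ => sone);
  sadd a b := ucls (fun i => sadd (urep a i) (urep b i));
  smul a b := ucls (fun i => smul (urep a i) (urep b i));
  slt a b := F (fun i => slt (urep a i) (urep b i)) |}.

Lemma ucls_add g h : sadd (ucls g : upower) (ucls h) = ucls (fun i => sadd (g i) (h i)).
Proof.
have H := (ultra_and _ _).2 (conj (urep_ucls g) (urep_ucls h)).
by apply/ucls_eq; apply: ultraS H => i [-> ->].
Qed.

Lemma ucls_mul g h : smul (ucls g : upower) (ucls h) = ucls (fun i => smul (g i) (h i)).
Proof.
have H := (ultra_and _ _).2 (conj (urep_ucls g) (urep_ucls h)).
by apply/ucls_eq; apply: ultraS H => i [-> ->].
Qed.

Lemma ucls_lt g h : slt (ucls g : upower) (ucls h) <-> F (fun i => slt (g i) (h i)).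
Proof.
have H := (ultra_and _ _).2 (conj (urep_ucls g) (urep_ucls h)).
by split=> /= Hlt; apply: ultraS ((ultra_and _ _).2 (conj H Hlt)) => i [[-> ->]].
Qed.

Lemma eval_upower (g : nat -> I -> M) t :
  eval (fun j => ucls (g j) : upower) t = ucls (fun i => eval (fun j => g j i) t).
Proof.
elim: t => //= t1 -> t2 ->; [exact: ucls_add|exact: ucls_mul].
Qed.

Definition los (p : formula) : Prop := forall g : nat -> I -> M,
  sat (fun j => ucls (g j) : upower) p <-> F (fun i => sat (fun j => g j i) p).

(** Reduces the remaining connectives to negation, conjunction and existence. *)
Lemma los_ext p q :
  (forall (L : structure) (e : nat -> L), sat e p <-> sat e q) -> los p -> los q.
Proof.
move=> pq Hp g; rewrite -pq Hp.
by split; apply: ultraS => i; rewrite pq.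
Qed.

Lemma los_not p : los p -> los (Not p).
Proof. by move=> Hp g /=; rewrite Hp -ultra_not. Qed.

Lemma los_and p q : los p -> los q -> los (And p q).
Proof. by move=> Hp Hq g /=; rewrite Hp Hq -ultra_and. Qed.

Lemma los_Ex p : los p -> los (Ex p).
Proof.
move=> Hp g /=; have sc (h : I -> M) : scons (ucls h : upower) (fun j => ucls (g j)) =
    (fun j => ucls (scons h g j)) by apply: funext => -[].
have sc' (h : I -> M) i : (fun j => scons h g j i) = scons (h i) (fun j => g j i).
  by apply: funext => -[].
split=> [[a]|H].
  rewrite -(urepK a) sc Hp; apply: ultraS => i; rewrite sc'; by exists (urep a i).
(* A witness is chosen at each index that has one; the default [szero] elsewhere is harmless, as the
   good indices form a set in [F]. *)
have /boolp.choice[h Hh] i : exists a, (exists b, sat (scons b (fun j => g j i)) p) ->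
    sat (scons a (fun j => g j i)) p.
  case: (pselect (exists b, sat (scons b (fun j => g j i)) p)) => [[b Hb]|Hn].
    by exists b.
  by exists szero.
exists (ucls h); rewrite sc Hp; apply: ultraS H => i Hi.
by rewrite sc'; exact: Hh.
Qed.

Lemma los_all p : los p.
Proof.
elim: p => [t1 t2|t1 t2|p IHp|p IHp q IHq|p IHp q IHq|p IHp q IHq|p IHp|p IHp].
- by move=> g; rewrite -ucls_eq -!eval_upower.
- by move=> g; rewrite -ucls_lt -!eval_upower.
- exact: los_not.
- exact: los_and.
- apply: los_ext (los_not (los_and (los_not IHp) (los_not IHq))) => L e /=.
  by case: (pselect (sat e p)); case: (pselect (sat e q)) => ? ?; tauto.
- apply: los_ext (los_not (los_and IHp (los_not IHq))) => L e /=.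
  by case: (pselect (sat e p)); case: (pselect (sat e q)) => ? ?; tauto.
- apply: los_ext (los_not (los_Ex (los_not IHp))) => L e /=.
  by split=> [H a|H [a]]; [apply: contrapT => Ha; apply: H; exists a|apply].
- exact: los_Ex.
Qed.

Definition diag : embedding M upower.
Proof.
apply: (@Embedding M upower (fun a => ucls (fun _ => a))).
- by move=> a b /ucls_eq/ultra_const.
- by [].
- by [].
- by move=> a b; rewrite ucls_add.
- by move=> a b; rewrite ucls_mul.
- by move=> a b; rewrite ucls_lt ultra_const.
Defined.

Lemma diag_elementary : elementary diag.
Proof. by move=> p _ e; rewrite /= los_all ultra_const. Qed.

End Ultrapower.

(** * From elementarity of cofinal closures to strong collection *)

Lemma PAminus_elementary (M N : structure) (f : embedding M N) :
  elementary f -> PAminus M -> PAminus N.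
Proof.
move=> elf hM; pose e0 : nat -> M := fun _ => szero.
(* Each axiom is a sentence whose satisfaction unfolds by computation to the axiom itself, so [tr]
   carries it over. *)
have tr p : sat e0 p -> sat (fun i => f (e0 i)) p by exact: (elf p I e0).1.
have [H1 H2 H3 H4 H5 H6 H7 H8 H9 H10 H11 H12 H13 H14 H15 H16 H17] := hM.
pose x := Var 2; pose y := Var 1; pose z := Var 0.
split.
- exact: (tr (All (All (All (Eq (Add (Add x y) z) (Add x (Add y z)))))) H1).
- exact: (tr (All (All (Eq (Add y z) (Add z y)))) H2).
- exact: (tr (All (All (All (Eq (Mul (Mul x y) z) (Mul x (Mul y z)))))) H3).
- exact: (tr (All (All (Eq (Mul y z) (Mul z y)))) H4).
- exact: (tr (All (All (All (Eq (Mul x (Add y z)) (Add (Mul x y) (Mul x z)))))) H5).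
- exact: (tr (All (Eq (Add z Zero) z)) H6).
- exact: (tr (All (Eq (Mul z Zero) Zero)) H7).
- exact: (tr (All (Eq (Mul z One) z)) H8).
- exact: (tr (All (All (All (Imp (Lt x y) (Imp (Lt y z) (Lt x z)))))) H9).
- exact: (tr (All (Not (Lt z z))) H10).
- exact: (tr (All (All (Or (Lt y z) (Or (Eq y z) (Lt z y))))) H11).
- exact: (tr (All (All (All (Imp (Lt x y) (Lt (Add x z) (Add y z)))))) H12).
- exact: (tr (All (All (All (Imp (Lt Zero z) (Imp (Lt x y) (Lt (Mul x z) (Mul y z))))))) H13).
(* Under [Ex] the indices shift: there [x] and [y] are the two outer variables and [z] is the
   difference. *)
- exact: (tr (All (All (Imp (Lt y z) (Ex (Eq (Add x z) y))))) H14).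
- exact: (tr (Lt Zero One) H15).
- exact: (tr (All (Imp (Lt Zero z) (Or (Lt One z) (Eq One z)))) H16).
- exact: (tr (All (Or (Lt Zero z) (Eq Zero z))) H17).
Qed.

(** The order is directed, so the upper cones generate a proper filter, which extends to an
    ultrafilter. *)
Lemma cofinal_ultrafilter (M : structure) : PAminus M ->
  exists2 F : (M -> Prop) -> Prop, filter.UltraFilter F & forall v, F (fun w => sle v w).
Proof.
move=> hM; pose cone (v w : M) := sle v w.
have FF : filter.ProperFilter (filter.filter_from (fun _ : M => True) cone).
  apply: filter.filter_from_proper => [|v _]; last by exists v; right.
  apply: filter.filter_from_filter => [|a b _ _]; first by exists szero.
  have [c /= [ac [bc _]]] := below_bound hM [:: a; b].
  exists c => // w cw; split; apply: (sle_trans hM) cw; by left.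
have [F [FU FS]] := filter.ultraFilterLemma FF.
by exists F => // v; apply: FS; exists v.
Qed.

Lemma sapp_fun (I T : Type) (s : seq (I -> T)) (e : nat -> I -> T) i :
  (fun j => sapp s e j i) = sapp [seq a i | a <- s] (fun j => e j i).
Proof. exact: (sapp_map (fun a : I -> T => a i)). Qed.

Lemma ultra_below (M : structure) (I : Type) (F : (I -> Prop) -> Prop)
    (FU : filter.UltraFilter F) (y : seq (upower M F)) v :
  below y (diag M FU v) ->
  F (fun i => below [seq a i | a <- map (@urep M I F) y] v).
Proof.
elim: y => [|a y IHy] /=; first by move=> _; exact: ultraT.
move=> [av /IHy yv]; apply/ultra_and; split=> //.
by rewrite -ucls_lt urepK.
Qed.

Lemma sup_elementary_Coll_s (M : structure) n : PAminus M ->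
  (forall (N : structure) (hN : PAminus N) (f : embedding M N),
     elementary f -> elementary_for (Sigma n.+1) (sup_incl hN f)) ->
  Coll_s (Sigma n.+1) M.
Proof.
move=> hM H p Sp k l z u; apply: contrapT => noV.
pose good (x : k.-tuple M) (y : l.-tuple M) := sat (sapp x (sapp y z)) p.
(* With [w] as the bound in every coordinate there is a bad tuple [x w]: it has a witness, but none
   below [w]. *)
have /boolp.choice[x Hx] (w : M) : exists x : k.-tuple M, tuple_lt x u /\
    ((exists y, good x y) /\ ~ exists y, tuple_lt y (nseq_tuple l w) /\ good x y).
  apply: contrapT => noX; apply: noV; exists (nseq_tuple l w) => x xu xy.
  by apply: contrapT => noY; apply: noX; exists x.
have [F FU Fcone] := cofinal_ultrafilter hM.
pose f := diag M FU; have elf := @diag_elementary M M F FU.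
have hN := PAminus_elementary elf hM.
have elS := H _ hN f elf.
(* [c] lists the classes of w |-> x_w, followed by the constant parameters [z]. The former lie below
   images of entries of [u], the latter in the image of M, so all are in the closure. *)
pose g (j : nat) (w : M) : M := sapp (x w) z j.
pose c (j : nat) : upower M F := ucls F (g j).
have c_sup j : in_sup f (c j).
  case: (ltnP j k) => jk.
    exists (nth szero u j); left; apply/ucls_lt; apply: ultraT => w.
    rewrite /g (sapp_nth szero) size_tuple jk.
    by have := (Hx w).1 (Ordinal jk); rewrite !(tnth_nth szero).
  exists (z (j - k)); right; apply/ucls_eq; apply: ultraT => w.
  by rewrite /g (sapp_nth szero) size_tuple ltnNge jk.
pose e (j : nat) : sup hN f := exist _ (c j) (c_sup j).
pose q := ren (swap_blocks l k) p.
have qE w (y : seq M) : size y = l ->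
    sat (sapp y (sapp (x w) z)) q <-> sat (sapp (x w) (sapp y z)) p.
  by move=> sy; have := sat_swap y (x w) z p; rewrite sy size_tuple.
have Sq : Sigma n.+1 q by exact: Sigma_ren.
have Sq' : Sigma n.+1 (iter l Ex q).
  by case: Sq => j [q' [Pq' ->]]; exists (l + j), q'; rewrite iterD.
(* By Los the ultrapower has a witness for [c]; elementarity of the closure yields one inside it. *)
have := (elS _ Sq' e).2; rewrite !sat_iter_Ex => -[|y [sy]].
  rewrite -sat_iter_Ex /=; apply/(@los_all _ _ _ FU); apply: ultraT => w.
  have [_ [[y Hy] _]] := Hx w.
  by rewrite sat_iter_Ex; exists y; rewrite qE ?size_tuple.
rewrite elS // sapp_map.
have [v] := in_sup_bound hM y; set s := map _ y => sv Hs.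
have := ultra_below sv; set r := map _ s => rv.
have rE : (fun j => ucls F (sapp r g j) : upower M F) = sapp s c.
  rewrite (sapp_map (ucls F)) -map_comp; congr sapp.
  by rewrite -[RHS]map_id; apply: eq_map => a /=; rewrite urepK.
have := Hs; rewrite [fun i => _](_ : _ = c) // -rE => /(@los_all _ _ _ FU) Hr.
(* Three sets of the ultrafilter meet: w above v, the representatives below v, and the truth of [q]
   at w. Such a w contradicts the choice of [x w]. *)
have [w [wv [ws wr]]] := ultra_ex FU ((ultra_and FU _ _).2 (conj (Fcone v)
  ((ultra_and FU _ _).2 (conj rv Hr)))).
have sr : size [seq a w | a <- r] == l by rewrite !size_map sy.
have [_ [_ []]] := Hx w; exists (Tuple sr); split.
  rewrite -(below_tuple_lt _ (@tnth_nseq_tuple M _ w)).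
  exact: (below_mono hM wv).
by move: wr; rewrite sapp_fun qE //; exact/eqP.
Qed.

(** * The cycle of implications between the four conditions *)

Theorem theorem3p1 (M : structure) (hM : PAminus M) (n : nat) :
  [<->
    forall (N : structure) (hN : PAminus N) (f : embedding M N),
      elementary f ->
      elementary_for (Sigma n.+1) (sup_incl hN f);
    Coll_s (Sigma n.+1) M;
    if n is 0 then
      forall (N : structure) (hN : PAminus N) (f : embedding M N),
        elementary_for (Sigma 1) f ->
        elementary_for (Sigma 1) (sup_incl hN f)
    else
      Coll (Sigma n) M /\
      forall (N : structure) (hN : PAminus N) (f : embedding M N),
        Coll (Sigma n) N ->
        elementary_for (Sigma n.+1) f ->
        elementary_for (Sigma n.+1) (sup_incl hN f);
    forall (N : structure) (hN : PAminus N) (f : embedding M N),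
      elementary_for (Sigma n.+2) f ->
      elementary_for (Sigma n.+1) (sup_incl hN f)].
Proof.
split; first exact: sup_elementary_Coll_s.
split.
  case: n => [|n] csM.
    move=> N hN f elf.
    by apply: (sup_elementary_Sigma hM csM _ _ elf (leqnn _)); split.
  have cM : Coll (Sigma n.+1) M.
    by apply: Coll_sub (Coll_s_Coll csM) => p; exact: (Sigma_mono (leqnSn _)).
  split=> // N hN f cN elf.
  by apply: (sup_elementary_Sigma hM csM _ _ elf (leqnn _)); split.
have el_mono N (f : embedding M N) :
    elementary_for (Sigma n.+2) f -> elementary_for (Sigma n.+1) f.
  by apply: elementary_for_sub => p; exact: (Sigma_mono (leqnSn _)).
(* The last condition gives the first because full elementarity includes Sigma n.+2. *)
split; last by move=> H N hN f elf; apply: H => p _; exact: elf.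
case: n el_mono => [|n] el_mono; first by move=> H N hN f /el_mono; exact: H.
move=> [cM H] N hN f elf; apply: H; last exact: el_mono.
(* What remains of the third condition's hypotheses is Coll(Sigma n.+1) in N. *)
exact: (Coll_transfer hN (conj hM (fun _ => cM)) elf).2.
Qed.
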